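(* Let $a,b,g,h$ be real functions that are Lebesgue measurable and locally essentially bounded, with $a(t)\ge 0$, $b(t)\ge 0$, $g(t)\le t$, $h(t)\ge t$ and $\lim_{t\to\infty} g(t)=\infty$. Suppose $a(t)\ge b(t)$. Then the following three conditions are equivalent: 1. The differential inequality $$\dot{x}(t)+a(t)x(g(t))-b(t)x(h(t))\le 0,\quad t\ge t_0,$$ has an eventually nonincreasing positive solution. 2. The integral inequality $$u(t)\ge a(t)\exp\left\{\int_{g(t)}^t u(s)\,ds\right\}-b(t)\exp\left\{-\int_t^{h(t)}u(s)\,ds\right\},\quad t\ge t_1,$$ has a nonnegative locally integrable solution $u$ for some $t_1\ge t_0$, where it is assumed that $u(t)=0$ for $t<t_1$. 3. The differential equation $$\dot{x}(t)+a(t)x(g(t))-b(t)x(h(t))=0,\quad t\ge t_0,$$ has an eventually positive nonincreasing solution.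
   Context: The functions $a,b,g,h$ are considered for $t\ge t_0$. A solution of the differential equation is a function $x:\mathbb{R}\to\mathbb{R}$, absolutely continuous on each interval $[t_0,c]$, which satisfies the equation for almost all $t\in[t_0,\infty)$ and satisfies $x(t)=\varphi(t)$ for $t<t_0$, $x(t_0)=x_0$, for some initial function $\varphi$ and initial value $x_0$. Solutions of the differential inequality are understood in the same sense. ''Eventually'' means for all sufficiently large $t$.
   Formalization: In conditions 1 and 3 the solution may start at some t1 ≥ t0 (equation or inequality for almost all t ≥ t1) rather than at t0; with the start fixed at t0, condition 2 does not imply 1 or 3 (e.g. t0=0, a=1, b=0, h(t)=t, g=0 on [0,1], g(t)=t for t>1). *)

(* Defs.v *)
From HB Require Import structures.
From mathcomp Require Import all_boot all_order all_algebra.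
From mathcomp Require Import all_classical all_reals all_analysis.
Set Implicit Arguments.
Unset Strict Implicit.
Unset Printing Implicit Defensive.
Import Order.TTheory GRing.Theory Num.Theory numFieldNormedType.Exports.
Local Open Scope classical_set_scope.
Local Open Scope ring_scope.

(* The real line with the Lebesgue sigma-algebra; measurable_fun on R itself
   would mean Borel measurability. *)
Definition leb_line (R : realType) :=
  caratheodory_type ((wlength (@idfun R))^*)%mu.

Section MixedEquation.
Context {R : realType}.
Implicit Types (a b g h u x phi f : R -> R) (t : R) (D : set R).

Local Notation mu := (@completed_lebesgue_measure R).

Definition lebesgue_measurable_fun D f :=
  measurable_fun (D : set (leb_line R)) (f : leb_line R -> R).

Definition locally_ess_bounded (t0 : R) f :=
  forall c, exists M, \forall t \ae mu, t0 <= t <= c -> `|f t| <= M.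

Definition locally_lebesgue_integrable u :=
  forall K : set R, compact K ->
    mu.-integrable (K : set (leb_line R)) (EFin \o u).

Definition absolutely_continuous_on (p q : R) f :=
  forall e, 0 < e -> exists2 d, 0 < d &
    forall (n : nat) (l r : 'I_n -> R),
      (forall i, [/\ p <= l i, l i <= r i & r i <= q]) ->
      trivIset setT (fun i => `]l i, r i[%classic) ->
      \sum_(i < n) (r i - l i) < d ->
      \sum_(i < n) `|f (r i) - f (l i)| < e.

Definition mixed_ineq a b g h x t : Prop :=
  derive1 x t + a t * x (g t) - b t * x (h t) <= 0.

Definition mixed_eq a b g h x t : Prop :=
  derive1 x t + a t * x (g t) - b t * x (h t) = 0.

(* [E x t] is the equation or inequality for [x] at time [t]; [phi] and [x0]
   are the initial function and the initial value. *)
Definition solution (E : (R -> R) -> R -> Prop) (t1 : R) phi (x0 : R) x :=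
  [/\ forall c, t1 <= c -> absolutely_continuous_on t1 c x,
      \forall t \ae mu, t1 <= t -> derivable x t 1 /\ E x t,
      forall t, t < t1 -> x t = phi t
    & x t1 = x0].

Definition eventually_positive_nonincreasing x :=
  exists T, (forall t, T <= t -> 0 < x t) /\
            (forall s t, T <= s -> s <= t -> x t <= x s).

(* The initial point [t1] may lie to the right of [t0].  With [t1 = t0] imposed,
   the integral inequality would not yield a solution: let t0 = 0, a = 1, b = 0,
   h(t) = t, g = 0 on [0, 1] and g(t) = t for t > 1.  Every solution of the
   equation or of the inequality on [0, +oo[ has x(1) <= x(0) - x(0) = 0, hence
   x <= 0 on [1, +oo[, whereas u = 1 on [1, +oo[ solves the integral
   inequality with t1 = 1. *)
Definition has_eventually_positive_nonincreasing_solution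
    (E : (R -> R) -> R -> Prop) (t0 : R) :=
  exists (t1 : R) phi (x0 : R) x, [/\ t0 <= t1, solution E t1 phi x0 x
    & eventually_positive_nonincreasing x].

Definition integral_ineq_solution a b g h (t1 : R) u :=
  [/\ locally_lebesgue_integrable u,
      forall t, 0 <= u t,
      forall t, t < t1 -> u t = 0
    & forall t, t1 <= t ->
        u t >= a t * expR (\int[mu]_(s in `[g t, t]) u s)
               - b t * expR (- \int[mu]_(s in `[t, h t]) u s)].

End MixedEquation.

(* Main.v *)
Require Import Defs.
From HB Require Import structures.
From mathcomp Require Import all_boot all_order all_algebra.
From mathcomp Require Import all_classical all_reals all_analysis.
From mathcomp Require Import measurable_realfun.
From mathcomp Require Import lra.
Set Implicit Arguments.
Unset Strict Implicit.
Unset Printing Implicit Defensive.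
Import Order.TTheory GRing.Theory Num.Theory numFieldNormedType.Exports.
Local Open Scope classical_set_scope.
Local Open Scope ring_scope.

(** The substitution [x(t) = exp (- int_[t1, t] u)], that is [u = - x' / x],
    turns the functional equation into the integral equation
    [u = delay_operator a b g h u], because
    [x (g t) / x t = exp (int_[g t, t] u)] and
    [x (h t) / x t = exp (- int_[t, h t] u)].  It also turns the differential
    inequality into the integral inequality [u >= delay_operator a b g h u].

    From the differential to the integral inequality, take [u = - x' / x] far
    enough to the right for [x] and [x o g] to be positive and nonincreasing.
    Both occurrences of the integral act in the same direction: the operator is
    nondecreasing in [u].  So it suffices that the integral of [u] over [[s, t]]
    is at most [ln (x s / x t)], the half of the fundamental theorem of calculus
    that holds for every monotone function ([integral_lower_derivative_le],
    [log_derivative_minorant]).  The inequality then holds almost everywhere, and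
    raising [u] on a null set makes it hold everywhere
    ([integral_ineq_of_solution]).

    From the integral inequality to the equation, iterate the operator from [u].
    It is nondecreasing, it maps nonnegative functions to nonnegative ones
    because [b <= a], and it maps [u] below [u]; so the iterates decrease to a
    limit [w >= 0], a fixed point by dominated convergence
    ([delay_operator_fixpoint]).  Then [x(t) = exp (- int_[t1, t] w)] is locally
    absolutely continuous, and by Lebesgue's differentiation theorem it solves
    the equation ([solution_of_fixpoint]).  A solution of the equation solves the
    inequality, which closes the cycle.

    The equation and both inequalities involve the completed Lebesgue measure
    [cmu], while Lebesgue's differentiation theorem is about the Borel measure
    [mu]; [locally_integrable_representative] passes from one to the other. *)

Local Notation cmu := (@completed_lebesgue_measure _).
Local Notation mu := (@lebesgue_measure _).

(** * Lebesgue measurability and Borel representatives *)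

Lemma measurable_leb_line (R : realType) (A : set R) :
  measurable A -> measurable (A : set (leb_line R)).
Proof. by move=> mA; exact: sub_caratheodory. Qed.

Lemma measurable_fun_leb_line d (T : measurableType d) (R : realType)
    (f : R -> T) :
  measurable_fun [set: R] f -> measurable_fun (setT : set (leb_line R)) f.
Proof.
move=> mf _ B mB; apply: measurable_leb_line; exact: mf.
Qed.

Lemma ae_completed (R : realType) (P : R -> Prop) :
  {ae (@lebesgue_measure R), forall t, P t} ->
  {ae (@completed_lebesgue_measure R), forall t, P t}.
Proof.
move=> [N [mN N0 sN]]; exists N; split => //; exact: measurable_leb_line.
Qed.

Lemma ae_completedS (R : realType) (P Q : R -> Prop) :
  (forall t, P t -> Q t) ->
  {ae (@completed_lebesgue_measure R), forall t, P t} ->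
  {ae (@completed_lebesgue_measure R), forall t, Q t}.
Proof.
move=> PQ [N [mN N0 sN]]; exists N; split => // t nQ; apply: sN => Pt.
by apply: nQ; exact: PQ.
Qed.

Lemma ae_completedI (R : realType) (P Q : R -> Prop) :
  {ae (@completed_lebesgue_measure R), forall t, P t} ->
  {ae (@completed_lebesgue_measure R), forall t, Q t} ->
  {ae (@completed_lebesgue_measure R), forall t, P t /\ Q t}.
Proof.
move=> aP aQ.
have := @filterI _ _ (ae_filter_ringOfSetsType (@completed_lebesgue_measure R)).
by move=> /(_ _ _ aP aQ).
Qed.

(** On Borel sets the two measures agree, so [mu] is the image of [cmu] under
    the identity from the completed line to the Borel line. *)
Lemma ge0_integral_completed (R : realType) (D : set R) (f : R -> \bar R) :
  measurable D -> measurable_fun [set: R] f -> (forall t, 0 <= f t)%E ->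
  (\int[cmu]_(t in (D : set (leb_line R))) f t =
   \int[mu]_(t in D) f t)%E.
Proof.
move=> mD mf f0.
have mid : measurable_fun (setT : set (leb_line R))
  (id : leb_line R -> measurableTypeR R) by exact: measurable_fun_leb_line.
have h := @ge0_integral_pushforward _ _ (leb_line R) (measurableTypeR R) R
  (id : leb_line R -> measurableTypeR R) mid (@completed_lebesgue_measure R) D
  (f : measurableTypeR R -> \bar R) mD (measurable_funTS mf) (fun y _ => f0 y).
have -> : (\int[mu]_(t in D) f t =
  \int[pushforward (@completed_lebesgue_measure R)
    (id : leb_line R -> measurableTypeR R)]_(t in D) f t)%E.
  exact: eq_measure_integral.
by rewrite h.
Qed.

(** The completed sigma-algebra only adds subsets of Borel null sets, so the
    countably many sets [f > q] with [q] rational become Borel once a single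
    null set is discarded; [f] is set to [0] there. *)
Lemma borel_representative (R : realType) (f : R -> R) :
  measurable_fun (setT : set (leb_line R)) f -> (forall t, 0 <= f t) ->
  exists v : R -> R, [/\ measurable_fun [set: R] v, (forall t, 0 <= v t) &
    {ae (@lebesgue_measure R), forall t, v t = f t}].
Proof.
move=> mf f0.
have H (q : rat) : exists BN : set R * set R, [/\ measurable BN.1,
    measurable BN.2, mu BN.2 = 0%E, BN.1 `<=` f @^-1` `]ratr q, +oo[ &
    f @^-1` `]ratr q, +oo[ `<=` BN.1 `|` BN.2].
  have : measurable (f @^-1` `]ratr q, +oo[ : set (leb_line R)).
    by rewrite -[X in measurable X]setTI; apply: mf.
  rewrite -[measurable _]/(((wlength (@idfun R))^*)%mu.-cara.-measurable _).
  rewrite -completed_caratheodory_measurable g_sigma_completed_algebra_genE.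
  move=> [B mB [M [N [mN N0 MN]]] <-].
  by exists (B, N); split => //= t [|/MN]; [left|right].
have [BN HBN] := choice H.
have pick_ (q : rat) : exists n, unpickle n = Some q.
  by exists (pickle q); rewrite pickleK.
pose N := \bigcup_n (if unpickle n is Some q then (BN q).2 else set0 : set R).
have mN : measurable N.
  apply: bigcupT_measurable => n; case: unpickle => [q|//].
  by have [] := HBN q.
have N0 : mu N = 0%E.
  apply: measure_negligible => //; rewrite /N.
  apply: negligible_bigcup => n /=.
  case: (unpickle n) => [q|]; last by exists set0; split.
  by have [_ m2 z _ _] := HBN q; exists (BN q).2; split.
exists (fun t => if t \in N then 0 else f t); split; last first.
- exists N; split => // t /=; apply: contra_notP => Nt.
  by rewrite memNset.
- by move=> t; case: ifP.
apply: (measurability (@RGenOInfty.G R)) => [|/= _ [_] [r] -> <-].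
  exact: RGenOInfty.measurableE.
rewrite setTI.
(* Off [N], [f t > r] exactly when [t] is in the Borel part [(BN q).1] of
   [f > q] for some rational [q >= r]. *)
have -> : (fun t => if t \in N then 0 else f t) @^-1` `]r, +oo[ =
   (N `&` [set t | r < 0]) `|` \bigcup_n
     (if unpickle n is Some q then
        (if r <= ratr q then ~` N `&` (BN q).1 else set0) else set0 : set R).
  apply/seteqP; split => [t /=|t].
    have [Nt|Nt] := pselect (N t).
      by rewrite mem_set// in_itv/= andbT => r0; left.
    rewrite memNset// in_itv/= andbT => rt; right.
    have [q] := rat_in_itvoo rt; rewrite in_itv/= => /andP[rq qt].
    have [n nq] := pick_ q; exists n => //; rewrite nq (ltW rq); split => //.
    have [_ _ _ _ /(_ t)[]//=] := HBN q; first by rewrite in_itv/= andbT.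
    by move=> Nqt; exfalso; apply: Nt; exists n => //; rewrite nq.
  case=> [[Nt /= r0]|[n _]]; first by rewrite mem_set// in_itv/= andbT.
  case: unpickle => [q|//]; case: ifPn => // rq [Nt Bt] /=.
  rewrite memNset//.
  have [_ _ _ /(_ t Bt)/= + _] := HBN q.
  by rewrite !in_itv/= !andbT; exact: le_lt_trans.
apply: measurableU.
  apply: measurableI => //.
  by have [r0|r0] := pselect (r < 0);
    [rewrite (_ : mkset _ = setT)|rewrite (_ : mkset _ = set0)] => //;
    apply/seteqP; split.
apply: bigcupT_measurable => n; case: (unpickle n) => [q|//].
case: ifPn => // _; apply: measurableI; first exact: measurableC.
by have [] := HBN q.
Qed.

(** * Integrals over intervals *)

Lemma Rintegral_split (R : realType) (v : R -> R) (p s t : R) :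
  mu.-integrable `[p, t] (EFin \o v) -> p <= s -> s <= t ->
  \int[mu]_(x in `[p, t]) v x =
  \int[mu]_(x in `[p, s]) v x + \int[mu]_(x in `[s, t]) v x.
Proof.
move=> iv ps st.
rewrite -(Rintegral_itv_obnd_cbnd (r := s) (b := BRight t)); last first.
  by apply: integrableS iv => //; apply: subset_itvr; rewrite bnd_simp.
rewrite -(@Rintegral_itvB _ _ (BLeft p) (BRight t) s) ?bnd_simp//.
by rewrite addrC subrK.
Qed.

Lemma locally_integrable_measurable (R : realType) (u : R -> R) :
  locally_lebesgue_integrable u ->
  measurable_fun (setT : set (leb_line R)) u.
Proof.
move=> iu.
have TE : (setT : set (leb_line R)) =
    \bigcup_n (`[- n%:R, n%:R]%classic : set (leb_line R)).
  apply/seteqP; split => // t _; exists (Num.truncn `|t|).+1 => //=.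
  by rewrite in_itv/= -ler_norml ltW// truncnS_gt.
rewrite TE; apply/measurable_fun_bigcup.
  by move=> n; apply: measurable_leb_line.
move=> n; apply/measurable_EFinP.
have /iu/integrableP[] // : compact (`[- n%:R, n%:R]%classic : set R).
exact: segment_compact.
Qed.

(** The bridge to the Borel measure: [v] inherits every integral of [u], so
    statements about primitives of [u] may be proved for [v]. *)
Lemma locally_integrable_representative (R : realType) (u : R -> R) :
  locally_lebesgue_integrable u -> (forall t, 0 <= u t) ->
  exists v : R -> R, [/\ locally_integrable setT v, (forall t, 0 <= v t),
    {ae (@completed_lebesgue_measure R), forall t, v t = u t} &
    forall D : set R, measurable D ->
      \int[cmu]_(t in (D : set (leb_line R))) u t =
      \int[mu]_(t in D) v t].
Proof.
move=> iu u0; have mu' := locally_integrable_measurable iu.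
have [v [mv v0 vu]] := borel_representative mu' u0.
have cvu := ae_completed vu.
have E (D : set R) : measurable D ->
    (\int[cmu]_(t in (D : set (leb_line R))) (u t)%:E
     = \int[mu]_(t in D) (v t)%:E)%E.
  move=> mD; rewrite -ge0_integral_completed//; last exact/measurable_EFinP.
  apply: ge0_ae_eq_integral.
  - exact: measurable_leb_line.
  - by apply/measurable_EFinP; exact: measurable_funTS.
  - apply/measurable_EFinP; apply: measurable_funTS.
    exact: measurable_fun_leb_line.
  - by move=> t _; rewrite lee_fin.
  - by move=> t _; rewrite lee_fin.
  - by apply: ae_completedS cvu => t /= -> _.
exists v; split => //; last by move=> D mD; rewrite /Rintegral E.
split => //; first exact: openT.
move=> K _ cK; have mK := compact_measurable cK.
under eq_integral do rewrite ger0_norm//.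
rewrite -E//; have /integrableP[_] := iu _ cK.
by under eq_integral do rewrite /= ger0_norm//.
Qed.

Lemma Rintegral_completed_split (R : realType) (u : R -> R) (p s t : R) :
  locally_lebesgue_integrable u -> (forall t, 0 <= u t) -> p <= s -> s <= t ->
  \int[cmu]_(x in `[p, t]) u x =
  \int[cmu]_(x in `[p, s]) u x +
  \int[cmu]_(x in `[s, t]) u x.
Proof.
move=> iu u0 ps st.
have [v [[mv _ iv] v0 _ E]] := locally_integrable_representative iu u0.
have iv' (x y : R) : mu.-integrable `[x, y] (EFin \o v).
  apply/integrableP; split; first exact/measurable_EFinP/measurable_funTS.
  exact/iv/segment_compact.
by rewrite !E//; exact: Rintegral_split.
Qed.

(** * Integrating the derivative of a monotone function *)

(** Lebesgue measure is determined by its values on half-open intervals, whose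
    length a translation preserves. *)
Lemma lebesgue_measure_shift (R : realType) (c : R) (A : set R) :
  measurable A ->
  pushforward mu ((fun x => x + c) : _ -> measurableTypeR R) A = mu A.
Proof.
move=> mA; apply/esym.
have mc : measurable_fun [set: measurableTypeR R]
  ((fun x => x + c) : measurableTypeR R -> measurableTypeR R).
  exact: measurable_funD.
pose mc' := isMeasurableFun.Build _ _ _ _ _ mc.
pose mc'' : {mfun measurableTypeR R >-> measurableTypeR R} :=
  HB.pack ((fun x => x + c) : measurableTypeR R -> measurableTypeR R) mc'.
apply: (lebesgue_measure_unique (mu := pushforward mu mc'')) => //=.
move=> _ [[a b]] _ <-.
rewrite /pushforward/=.
have -> : ((fun x => x + c) @^-1` `]a, b] = `]a - c, b - c]%classic)%R.
  by apply/seteqP; split => x /=; rewrite !in_itv/= ltrBlDr lerBrDr.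
rewrite !lebesgue_measure_itv/= !lte_fin ltrD2r.
by case: ifP => // _; rewrite -!EFinD opprB addrA subrK.
Qed.

Lemma ge0_integral_shift (R : realType) (f : R -> \bar R) (c s t : R) :
  measurable_fun [set: R] f -> (forall x, 0 <= f x)%E ->
  (\int[mu]_(x in `[s, t]) f (x + c)%R =
   \int[mu]_(x in `[(s + c)%R, (t + c)%R]) f x)%E.
Proof.
move=> mf f0.
have mc : measurable_fun [set: measurableTypeR R]
  ((fun x => x + c) : measurableTypeR R -> measurableTypeR R).
  exact: measurable_funD.
have -> : (`[s, t] = ((fun x => x + c) : measurableTypeR R -> measurableTypeR R)
    @^-1` `[(s + c)%R, (t + c)%R])%classic.
  by apply/seteqP; split => x /=; rewrite !in_itv/= !lerD2r.
rewrite -(@ge0_integral_pushforward _ _ (measurableTypeR R) (measurableTypeR R) R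
  _ mc mu _ f)//=; last exact: measurable_funTS.
by apply: eq_measure_integral => A mA _; exact: lebesgue_measure_shift.
Qed.

Lemma limn_einf_near (R : realType) (u v : (\bar R)^nat) (N : nat) :
  (forall n, (N <= n)%N -> u n = v n) -> limn_einf u = limn_einf v.
Proof.
move=> uv; rewrite !limn_einf_lim; apply/cvg_lim => //.
apply: (cvg_trans _ (@is_cvg_einfs _ v)).
apply: near_eq_cvg; exists N => // n /= Nn.
rewrite /einfs /sdrop /=; congr ereal_inf.
by apply: eq_imagel => k /= nk; rewrite uv// (leq_trans Nn).
Qed.

Lemma nondecreasing_integrable (R : realType) (F : R -> R) (s t : R) :
  nondecreasing_fun F -> mu.-integrable `[s, t] (EFin \o F).
Proof.
move=> ndF; apply: measurable_bounded_integrable => //.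
- exact/compact_finite_measure/segment_compact.
- exact: nondecreasing_measurable.
- exists (Num.max `|F s| `|F t|); split; first exact: num_real.
  move=> M sM x /=; rewrite in_itv/= => /andP[sx xt].
  apply: le_trans (ltW sM); rewrite le_max; have [F0|F0] := ger0P (F x).
    by rewrite [X in _ || X](le_trans (ndF _ _ xt)) ?orbT// ler_norm.
  by rewrite -normrN (le_trans _ (ler_norm _))// lerN2 ndF.
Qed.

(** The lower limit of the right difference quotients along the steps
    [1 / n]: unlike the derivative it exists everywhere and is Borel
    measurable. *)
Definition lower_derivative (R : realType) (F : R -> R) (t : R) : \bar R :=
  limn_einf (fun n => (n.+1%:R * (F (t + n.+1%:R^-1) - F t))%:E).

Lemma lower_derivative_ge0 (R : realType) (F : R -> R) (t : R) :
  nondecreasing_fun F -> (0 <= lower_derivative F t)%E.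
Proof.
move=> ndF; rewrite /lower_derivative limn_einf_lim; apply: lime_ge.
  exact: is_cvg_einfs.
apply: nearW => n; apply: le_ereal_inf_tmp => _ [k /= _ <-].
by rewrite lee_fin mulr_ge0// subr_ge0 ndF// lerDl.
Qed.

Lemma measurable_lower_derivative (R : realType) (F : R -> R) :
  nondecreasing_fun F -> measurable_fun [set: R] (lower_derivative F).
Proof.
move=> ndF; apply: measurableT_comp => //; apply: measurable_fun_limn_esup => n.
apply: measurableT_comp => //; apply/measurable_EFinP.
apply: measurable_funM => //; apply: measurable_funB.
  apply: measurableT_comp; first exact: nondecreasing_measurable.
  exact: measurable_funD.
exact: nondecreasing_measurable.
Qed.

(** After a translation the two integrals share all but the end pieces
    [[t, t + d]] and [[s, s + d]], on which monotonicity bounds [F]. *)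
Lemma Rintegral_quotient_le (R : realType) (F : R -> R) (d s t : R) :
  nondecreasing_fun F -> (forall x, 0 <= F x) -> 0 < d -> s <= t ->
  \int[mu]_(x in `[s, t]) (F (x + d) - F x) <= d * (F (t + d) - F s).
Proof.
move=> ndF F0 d0 st.
have iF (p q : R) : mu.-integrable `[p, q] (EFin \o F).
  exact: nondecreasing_integrable.
have ndFd : nondecreasing_fun (fun x => F (x + d)).
  by move=> x y xy; rewrite ndF// lerD2r.
have JE (p q c : R) : p <= q -> \int[mu]_(x in `[p, q]) c = (q - p) * c.
  move=> pq; rewrite Rintegral_cst//= lebesgue_measure_itv/= lte_fin.
  rewrite mulrC; case: ifP => [|/negbT]; first by rewrite -EFinD.
  rewrite -leNgt => qp; have -> : p = q by apply/le_anti; rewrite pq qp.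
  by rewrite subrr !mul0r.
have ic (p q c : R) : mu.-integrable `[p, q] (EFin \o (fun=> c)).
  exact: nondecreasing_integrable.
rewrite RintegralB//; last exact: (nondecreasing_integrable _ _ ndFd).
have -> : \int[mu]_(x in `[s, t]) F (x + d) = \int[mu]_(x in `[s + d, t + d]) F x.
  rewrite /Rintegral -(ge0_integral_shift (f := EFin \o F))//.
  by apply/measurable_EFinP; exact: nondecreasing_measurable.
have sd : s <= s + d by rewrite lerDl ltW.
have td : t <= t + d by rewrite lerDl ltW.
(* Both sides of the split of [[s, t + d]], at [s + d] and at [t]. *)
have := Rintegral_split (iF s (t + d)) sd (lerD st (lexx d)).
rewrite (Rintegral_split (iF s (t + d)) st td) => E.
have lb : d * F s <= \int[mu]_(x in `[s, s + d]) F x.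
  rewrite -{1}(addKr s d) [- s + _]addrC -JE//; apply: le_Rintegral => //.
  by move=> x /=; rewrite in_itv/= => /andP[sx _]; exact: ndF.
have ub : \int[mu]_(x in `[t, t + d]) F x <= d * F (t + d).
  rewrite -{2}(addKr t d) [- t + _]addrC -JE//; apply: le_Rintegral => //.
  by move=> x /=; rewrite in_itv/= => /andP[_ xd]; exact: ndF.
rewrite mulrBr lerBlDr.
rewrite (_ : \int[mu]_(x in `[(s + d), (t + d)]) F x =
  \int[mu]_(x in `[s, t]) F x + \int[mu]_(x in `[t, t + d]) F x -
  \int[mu]_(x in `[s, s + d]) F x); last by rewrite E addrAC subrr add0r.
by rewrite [leRHS]addrC -addrA lerD2l lerB.
Qed.

(** Half of the fundamental theorem of calculus: Fatou's lemma applied to the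
    difference quotients, whose integrals [Rintegral_quotient_le] controls.  For
    a monotone function one cannot expect equality, as the Cantor function
    shows. *)
Lemma integral_lower_derivative_le (R : realType) (F : R -> R) (s t : R) :
  nondecreasing_fun F -> (forall x, 0 <= F x) -> s <= t ->
  (\int[mu]_(x in `[s, t]) lower_derivative F x <= (F t - F s)%:E)%E.
Proof.
move=> ndF F0 st.
(* Freezing [F] beyond [t] keeps the quotients near [t] from seeing [F] to the
   right of [t]; on [[s, t[] the lower derivative does not change. *)
pose G x := F (Num.min x t).
have ndG : nondecreasing_fun G.
  by move=> x y xy; apply: ndF; rewrite le_min !ge_min xy lexx orbT.
have G0 x : 0 <= G x by exact: F0.
pose g n x := (n.+1%:R * (G (x + n.+1%:R^-1) - G x))%:E.
have ndGn n : nondecreasing_fun (fun x => G (x + n.+1%:R^-1)).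
  by move=> x y xy; rewrite ndG// lerD2r.
have ig n : (\int[mu]_(x in `[s, t]) g n x <= (F t - F s)%:E)%E.
  have iq : mu.-integrable `[s, t] (EFin \o (fun x => G (x + n.+1%:R^-1) - G x)).
    have iGn := nondecreasing_integrable s t (ndGn n).
    have iG := nondecreasing_integrable s t ndG.
    have := integrableB _ iGn iG; rewrite /comp/=.
    by apply; exact: measurable_itv.
  rewrite /g; under eq_integral do rewrite EFinM.
  rewrite integralZl// -[X in (_ * X)%E]fineK; last first.
    exact: integrable_fin_num.
  rewrite -EFinM lee_fin -ler_pdivlMl ?ltr0n//.
  have := Rintegral_quotient_le ndG G0 (d := n.+1%:R^-1) _ st.
  rewrite invr_gt0 ltr0n => /(_ isT)/le_trans; apply.
  by rewrite /G (min_idPr _) ?lerDl// (min_idPl st).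
rewrite -integral_itv_bndo_bndc; last first.
  by apply: measurable_funTS; exact: measurable_lower_derivative.
have -> : (\int[mu]_(x in `[s, t[) lower_derivative F x =
           \int[mu]_(x in `[s, t[) lower_derivative G x)%E.
  apply: eq_integral => x; rewrite inE/= in_itv/= => /andP[_ xt].
  have [N _ HN] : \forall n \near \oo, n.+1%:R^-1 < t - x.
    by apply: near_infty_natSinv_lt (PosNum _); rewrite subr_gt0.
  apply: (limn_einf_near (N := N)) => n Nn; rewrite /G (min_idPl (ltW xt)).
  by rewrite (min_idPl _)// -lerBrDl ltW//; exact: HN.
rewrite integral_itv_bndo_bndc; last first.
  by apply: measurable_funTS; exact: measurable_lower_derivative.
apply: (le_trans (fatou mu _ _ _)) => //.
- move=> n; apply/measurable_EFinP/measurable_funTS; apply: measurable_funM => //.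
  by apply: measurable_funB; apply: nondecreasing_measurable.
- by move=> n x _; rewrite lee_fin mulr_ge0// subr_ge0 ndG// lerDl.
rewrite limn_einf_lim; apply: lime_le; first exact: is_cvg_einfs.
apply: nearW => n; apply: le_trans (ig n); apply: ereal_inf_lbound.
by exists n => //=.
Qed.

(** * From a positive solution to the integral inequality *)

Lemma locally_lebesgue_integrable_itv (R : realType) (u : R -> R) :
  (forall p q : R, (@completed_lebesgue_measure R).-integrable
     (`[p, q]%classic : set (leb_line R)) (EFin \o u)) ->
  locally_lebesgue_integrable u.
Proof.
move=> iu K cK; have [M [_ HM]] := compact_bounded cK.
apply: integrableS (iu (- (M + 1)) (M + 1)).
- exact: measurable_leb_line.
- by apply: measurable_leb_line; exact: compact_measurable.
- by move=> x Kx /=; rewrite in_itv/= -ler_norml; apply: HM => //; rewrite ltrDl.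
Qed.

(** The steps [1 / n] tend to [0] and avoid it, so they sample the limit that
    defines the derivative. *)
Lemma lower_derivative_derivable (R : realType) (F : R -> R) (t : R) :
  derivable F t 1 -> lower_derivative F t = (derive1 F t)%:E.
Proof.
move=> dF; rewrite /lower_derivative.
suff cv : (fun n => (n.+1%:R * (F (t + n.+1%:R^-1) - F t))%:E) @ \oo -->
    (derive1 F t)%:E by have [] := cvg_limn_einf_sup cv.
apply: cvg_EFin; first by apply: nearW => n.
have h0 : (fun n : nat => n.+1%:R^-1 : R) @ \oo --> (0:R)^'.
  move=> A [e /= e0 eA].
  have [N _ HN] : \forall n \near \oo, (n.+1%:R^-1 : R) < e.
    exact: (near_infty_natSinv_lt (PosNum e0)).
  exists N => // n /= Nn; apply: eA; last by rewrite gt_eqF.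
  by rewrite /= sub0r normrN gtr0_norm//; exact: HN.
have := cvg_comp _ _ h0 dF.
rewrite derive1E; apply: cvg_trans; apply: near_eq_cvg; near=> n.
by rewrite /= invrK /GRing.scale/= mulr1 [t + _]addrC.
Unshelve. all: by end_near. Qed.

(** [w] is the lower derivative of [- ln x], made constant to the left of [T] so
    that it is monotone on the whole line; the last clause is the inequality
    [integral_lower_derivative_le] for it. *)
Lemma log_derivative_minorant (R : realType) (x : R -> R) (T : R) :
  (forall t, T <= t -> 0 < x t) ->
  (forall s t, T <= s -> s <= t -> x t <= x s) ->
  exists w : R -> R, [/\ measurable_fun [set: R] w, (forall t, 0 <= w t),
    (forall t, T < t -> derivable x t 1 -> w t = - derive1 x t / x t) &
    forall s t, s <= t ->
      (\int[mu]_(r in `[s, t]) (w r)%:E <=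
       (ln (x (Num.max T s) / x (Num.max T t)))%:E)%E].
Proof.
move=> x_gt0 x_ni.
have TM t : T <= Num.max T t by rewrite le_max lexx.
have xM t : 0 < x (Num.max T t) by exact: x_gt0.
have xMpos t : x (Num.max T t) \is Num.pos by rewrite posrE.
(* Adding [ln (x T)] to [- ln x] makes [F] nonnegative. *)
pose F t := ln (x T) - ln (x (Num.max T t)).
have ndF : nondecreasing_fun F.
  move=> s t st; rewrite lerD2l lerN2 ler_ln// x_ni//.
  by rewrite ge_max TM le_max st orbT.
have F0 t : 0 <= F t by rewrite subr_ge0 ler_ln ?posrE ?x_gt0// x_ni.
exists (fun t => fine (lower_derivative F t)); split.
- by apply: measurableT_comp => //; exact: measurable_lower_derivative.
- by move=> t; exact/fine_ge0/lower_derivative_ge0.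
- move=> t Tt dx; have xt : 0 < x t by exact/x_gt0/ltW.
  have dlx : is_derive t (1:R) (@ln R \o x) ((x t)^-1 *: derive1 x t).
    rewrite derive1E; have := is_derive1_ln xt => dln.
    have dx' : is_derive t (1:R) x ('D_1 x t) by exact: derivableP.
    exact: is_derive1_comp.
  have dF : is_derive t (1:R) F (- ((x t)^-1 *: derive1 x t)).
    have -> : - ((x t)^-1 *: derive1 x t) = 0 - (x t)^-1 *: derive1 x t.
      by rewrite sub0r.
    apply: (@near_eq_is_derive _ _ _ (cst (ln (x T)) - (@ln R \o x))).
    near=> s; rewrite /F/=.
    by rewrite (max_idPr _)// ltW//; near: s; exact: lt_nbhsr.
  rewrite lower_derivative_derivable//= derive1E (@derive_val _ _ _ _ _ _ _ dF).
  by rewrite mulNr mulrC.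
- move=> s t st.
  apply: (@le_trans _ _ (\int[mu]_(r in `[s, t]) lower_derivative F r)%E).
    apply: ge0_le_integral => //.
    - by move=> r _; rewrite lee_fin; exact/fine_ge0/lower_derivative_ge0.
    - apply/measurable_EFinP/measurable_funTS; apply: measurableT_comp => //.
      exact: measurable_lower_derivative.
    - by apply: measurable_funTS; exact: measurable_lower_derivative.
    - move=> r _; have := lower_derivative_ge0 r ndF.
      by case: lower_derivative => //= _; exact: leey.
  apply: le_trans (integral_lower_derivative_le ndF F0 st) _.
  by rewrite ln_div// /F opprB addrC addrA subrK lexx.
Unshelve. all: by end_near. Qed.

(** The right-hand side of the integral inequality, seen as an operator on
    [u]. *)
Definition delay_operator (R : realType) (a b g h u : R -> R) (t : R) : R :=
  a t * expR (\int[cmu]_(s in `[g t, t]) u s) -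
  b t * expR (- \int[cmu]_(s in `[t, h t]) u s).

(** The first exponential is at least [1] and the second at most [1], so the
    operator is bounded below by [a - b]. *)
Lemma delay_operator_ge0 (R : realType) (a b g h u : R -> R) (t : R) :
  0 <= b t -> b t <= a t -> (forall s, 0 <= u s) ->
  0 <= delay_operator a b g h u t.
Proof.
move=> b0 ba u0; rewrite subr_ge0.
have a0 := le_trans b0 ba.
apply: (@le_trans _ _ (b t)).
  by rewrite ler_piMr// -expR0 ler_expR oppr_le0 Rintegral_ge0.
by rewrite (le_trans ba)// ler_peMr// -[leLHS]expR0 ler_expR Rintegral_ge0.
Qed.

(** The differential inequality read as a lower bound on [- dx / xt]: [e1] and [e2]
    stand for the two exponentials, [xt], [xg], [xh] for the values of [x] at [t], [g t],
    [h t], and [dx] for the derivative. *)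
Lemma logarithmic_ineq (R : realFieldType) (a b e1 e2 xt xg xh dx : R) :
  0 <= a -> 0 <= b -> e1 * xt <= xg -> xh <= e2 * xt ->
  dx + a * xg - b * xh <= 0 -> (a * e1 - b * e2) * xt <= - dx.
Proof. by move=> a0 b0 h1 h2 h3; nra. Qed.

(** The logarithmic derivative [u0] of the solution satisfies the integral
    inequality almost everywhere only, as the solution does its own.  On the
    exceptional set [u0] is replaced by the value of the operator; as the
    measure is complete, this changes neither measurability nor integrals,
    hence not the operator. *)
Lemma integral_ineq_of_solution (R : realType) (t0 : R) (a b g h : R -> R) :
  (forall t, t0 <= t -> 0 <= a t) -> (forall t, t0 <= t -> 0 <= b t) ->
  (forall t, t0 <= t -> g t <= t) -> (forall t, t0 <= t -> t <= h t) ->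
  g t @[t --> +oo] --> +oo -> (forall t, t0 <= t -> b t <= a t) ->
  has_eventually_positive_nonincreasing_solution (mixed_ineq a b g h) t0 ->
  exists2 t1, t0 <= t1 & exists u, integral_ineq_solution a b g h t1 u.
Proof.
move=> a_ge0 b_ge0 g_le h_ge g_lim b_le_a.
move=> [t1 [phi [x0 [x [t01 [_ sol _ _] [T [xpos xni]]]]]]].
pose T0 := Num.max T t1.
have TT0 : T <= T0 by rewrite le_max lexx.
have t1T0 : t1 <= T0 by rewrite le_max lexx orbT.
have x_gt0 t : T0 <= t -> 0 < x t by move=> /(le_trans TT0); exact: xpos.
have x_ni s t : T0 <= s -> s <= t -> x t <= x s.
  by move=> /(le_trans TT0); exact: xni.
have [w [mw w0 wD wI]] := log_derivative_minorant x_gt0 x_ni.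
(* The deviation [g t] must stay where [x] is positive and nonincreasing. *)
have [T' T0T' gT'] : exists2 T', T0 < T' & forall t, T' <= t -> T0 <= g t.
  have /cvgryPge/(_ T0)[M [_ HM]] := g_lim.
  exists (Num.max M T0 + 1); first by rewrite ltr_pwDr// le_max lexx orbT.
  move=> t Mt; apply: HM; apply: lt_le_trans Mt.
  by rewrite ltr_pwDr// le_max lexx.
have t0T' : t0 <= T' by rewrite (le_trans t01)// (le_trans t1T0)// ltW.
pose u0 t := if t < T' then 0 else w t.
have mu0 : measurable_fun [set: R] u0.
  by apply: measurable_fun_ifT => //; exact: measurable_fun_ltr.
have u0_ge0 t : 0 <= u0 t by rewrite /u0; case: ifP.
have u0w t : u0 t <= w t by rewrite /u0; case: ifP.
have eI s t : s <= t ->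
    (\int[cmu]_(r in (`[s, t]%classic : set (leb_line R)))
      (u0 r)%:E <= (ln (x (Num.max T0 s) / x (Num.max T0 t)))%:E)%E.
  move=> st; rewrite ge0_integral_completed//; last exact/measurable_EFinP.
  apply: le_trans (wI _ _ st); apply: ge0_le_integral => //.
  - by move=> r _; rewrite lee_fin.
  - by apply/measurable_EFinP; exact: measurable_funTS.
  - by apply/measurable_EFinP; exact: measurable_funTS.
  - by move=> r _; rewrite lee_fin.
have cu0 p q : (@completed_lebesgue_measure R).-integrable
     (`[p, q]%classic : set (leb_line R)) (EFin \o u0).
  apply/integrableP; split.
    apply/measurable_EFinP/measurable_funTS; exact: measurable_fun_leb_line.
  have [pq|qp] := leP p q; last first.
    by rewrite set_itv_ge ?integral_set0 ?bnd_simp -?ltNge.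
  under eq_integral do rewrite /= ger0_norm//.
  by apply: le_lt_trans (eI _ _ pq) _; rewrite ltry.
have rI s t : T0 <= s -> s <= t ->
    \int[cmu]_(r in `[s, t]) u0 r <= ln (x s / x t).
  move=> T0s st; rewrite -lee_fin /Rintegral fineK; last first.
    apply: integrable_fin_num => //; exact: measurable_leb_line.
  by have := eI _ _ st; rewrite !(max_idPr _)// (le_trans T0s).
have ae_ge : {ae (@completed_lebesgue_measure R), forall t,
    T' <= t -> delay_operator a b g h u0 t <= u0 t}.
  apply: ae_completedS sol => t Ht T't.
  have T0t : T0 < t by exact: lt_le_trans T't.
  have [dx Ex] := Ht (le_trans t1T0 (ltW T0t)).
  have t0t : t0 <= t by exact: le_trans T't.
  have xt := x_gt0 _ (ltW T0t).
  have gt0 := gT' _ T't.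
  have xg := x_gt0 _ gt0.
  have xh := x_gt0 _ (le_trans (ltW T0t) (h_ge _ t0t)).
  have e1 : expR (\int[cmu]_(s in `[g t, t]) u0 s)
      * x t <= x (g t).
    rewrite -ler_pdivlMr// -[leRHS]lnK ?posrE ?divr_gt0// ler_expR.
    by apply: rI => //; exact: g_le.
  have e2 : x (h t) <=
      expR (- \int[cmu]_(s in `[t, h t]) u0 s) * x t.
    rewrite -ler_pdivrMr// -[leLHS]lnK ?posrE ?divr_gt0// ler_expR lerNr.
    rewrite -lnV ?posrE ?divr_gt0// invf_div.
    by apply: rI; [exact: ltW|exact: h_ge].
  rewrite [leRHS]/u0 ltNge T't/= wD// ler_pdivlMr//.
  exact: logarithmic_ineq (a_ge0 _ t0t) (b_ge0 _ t0t) e1 e2 Ex.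
pose u t := if t < T' then 0 else Num.max (u0 t) (delay_operator a b g h u0 t).
have u_ge0 t : 0 <= u t by rewrite /u; case: ifP => // _; rewrite le_max u0_ge0.
have uu0 : {ae (@completed_lebesgue_measure R), forall t, u0 t = u t}.
  apply: ae_completedS ae_ge => t; rewrite /u /u0.
  by case: ltP => // T't /(_ isT)/max_idPl ->.
have mu_u : measurable_fun (setT : set (leb_line R)) (EFin \o u).
  apply: (@ae_measurable_fun _ _ _ _ (@completed_lebesgue_measure_is_complete R)
    setT (EFin \o u0)).
    by apply: ae_completedS uu0 => t /= -> _.
  by apply/measurable_EFinP; exact: measurable_fun_leb_line.
have mu_u0 : measurable_fun (setT : set (leb_line R)) (EFin \o u0).
  by apply/measurable_EFinP; exact: measurable_fun_leb_line.
have ueI p q : (\int[cmu]_(r in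
    (`[p, q]%classic : set (leb_line R))) (u r)%:E =
    \int[cmu]_(r in
    (`[p, q]%classic : set (leb_line R))) (u0 r)%:E)%E.
  apply: ge0_ae_eq_integral.
  - exact: measurable_leb_line.
  - exact: measurable_funTS.
  - exact: measurable_funTS.
  - by move=> r _; rewrite lee_fin.
  - by move=> r _; rewrite lee_fin.
  - by apply: ae_completedS uu0 => t /= -> _.
exists T' => //; exists u; split => //.
- apply: locally_lebesgue_integrable_itv => p q; apply/integrableP; split.
    exact: measurable_funTS.
  under eq_integral do rewrite /= ger0_norm//.
  rewrite ueI; have /integrableP[_] := cu0 p q.
  by under eq_integral do rewrite /= ger0_norm//.
- by move=> t tT'; rewrite /u tT'.
- move=> t T't; rewrite /Rintegral !ueI /u ltNge T't/= le_max lexx orbT//.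
Qed.

(** * A fixed point below a solution of the integral inequality *)

Lemma dominated_locally_integrable (R : realType) (u v : R -> R) :
  locally_lebesgue_integrable u ->
  measurable_fun (setT : set (leb_line R)) v ->
  (forall t, 0 <= v t) -> (forall t, v t <= u t) ->
  locally_lebesgue_integrable v.
Proof.
move=> iu mv v0 vu K cK.
have mK : measurable (K : set (leb_line R)).
  by apply: measurable_leb_line; exact: compact_measurable.
apply: le_integrable (iu _ cK) => //.
  by apply/measurable_EFinP; exact: measurable_funTS.
move=> t _ /=; rewrite lee_fin !ger0_norm//.
exact: le_trans (vu t).
Qed.

(** This monotonicity makes the primitive Borel measurable, so that its
    composition with a Lebesgue measurable deviation is measurable. *)
Lemma nondecreasing_primitive (R : realType) (v : R -> R) (p : R) :
  locally_lebesgue_integrable v -> (forall t, 0 <= v t) ->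
  nondecreasing_fun
    (fun t => \int[cmu]_(s in `[p, t]) v s).
Proof.
move=> iv v0 s t st; have [ps|sp] := leP p s.
  by rewrite (Rintegral_completed_split iv v0 ps st) lerDl Rintegral_ge0.
by rewrite set_itv_ge ?bnd_simp -?ltNge// Rintegral_set0 Rintegral_ge0.
Qed.

Lemma Rintegral_left_support (R : realType) (v : R -> R) (p t1 : R) :
  locally_lebesgue_integrable v -> (forall t, 0 <= v t) ->
  (forall t, t < t1 -> v t = 0) ->
  \int[cmu]_(s in `[p, t1]) v s = 0.
Proof.
move=> iv v0 v_lt; rewrite /Rintegral.
suff -> : (\int[cmu]_(s in
    (`[p, t1]%classic : set (leb_line R))) (v s)%:E = \int[cmu]_(s in
    (`[p, t1]%classic : set (leb_line R))) (cst 0 s))%E by rewrite integral0.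
apply: ge0_ae_eq_integral.
- exact: measurable_leb_line.
- apply/measurable_EFinP; apply: measurable_funTS.
  exact: locally_integrable_measurable.
- exact: measurable_cst.
- by move=> s _; rewrite lee_fin.
- by move=> s _; exact: lexx.
- exists [set t1]; split; first exact: measurable_leb_line.
    exact: lebesgue_measure_set1.
  move=> s /=; apply: contra_notP => /= /eqP st1; rewrite in_itv/=.
  by move=> /andP[_]; rewrite le_eqVlt (negbTE st1)/= => /v_lt ->.
Qed.

(** As [v] vanishes to the left of [t1], both integrals are increments of the
    primitive from [t1], even when [g t < t1]. *)
Lemma delay_operator_primitive (R : realType) (a b g h v : R -> R) (t1 t : R) :
  locally_lebesgue_integrable v -> (forall t, 0 <= v t) ->
  (forall t, t < t1 -> v t = 0) -> t1 <= t -> g t <= t -> t <= h t ->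
  let F t := \int[cmu]_(s in `[t1, t]) v s in
  delay_operator a b g h v t =
    a t * expR (F t - F (g t)) - b t * expR (- (F (h t) - F t)).
Proof.
move=> iv v0 v_lt t1t gt th F; rewrite /delay_operator /F.
rewrite (Rintegral_completed_split iv v0 t1t th) addrAC subrr add0r.
congr (_ * expR _ - _); have [t1g|gt1] := leP t1 (g t).
  by rewrite (Rintegral_completed_split iv v0 t1g gt) addrAC subrr add0r.
rewrite (@set_itv_ge _ _ (BLeft t1) (BRight (g t))) ?bnd_simp -?ltNge//.
rewrite Rintegral_set0 subr0 (Rintegral_completed_split iv v0 (ltW gt1) t1t).
have -> : \int[cmu]_(x in `[g t, t1]) v x = 0; last first.
  by rewrite add0r.
exact: Rintegral_left_support iv v0 v_lt.
Qed.

Lemma measurable_delay_operator (R : realType) (a b g h v : R -> R) (t1 : R) :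
  lebesgue_measurable_fun `[t1, +oo[ a -> lebesgue_measurable_fun `[t1, +oo[ b ->
  lebesgue_measurable_fun `[t1, +oo[ g -> lebesgue_measurable_fun `[t1, +oo[ h ->
  (forall t, t1 <= t -> g t <= t) -> (forall t, t1 <= t -> t <= h t) ->
  locally_lebesgue_integrable v -> (forall t, 0 <= v t) ->
  (forall t, t < t1 -> v t = 0) ->
  lebesgue_measurable_fun `[t1, +oo[ (delay_operator a b g h v).
Proof.
move=> ma mb mg mh g_le h_ge iv v0 v_lt.
pose F t := \int[cmu]_(s in `[t1, t]) v s.
have mF : measurable_fun [set: R] F.
  by apply: nondecreasing_measurable => //; exact: nondecreasing_primitive.
have mF1 : measurable_fun (`[t1, +oo[%classic : set (leb_line R)) F.
  by apply: measurable_funTS; exact: measurable_fun_leb_line.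
apply: (@eq_measurable_fun _ _ (leb_line R) R _ (fun t =>
  a t * expR (F t - F (g t)) - b t * expR (- (F (h t) - F t)))).
  move=> t; rewrite inE/= in_itv/= andbT => t1t.
  by rewrite (delay_operator_primitive _ _ iv v0 v_lt t1t (g_le _ t1t) (h_ge _ t1t)).
have mFc k : lebesgue_measurable_fun `[t1, +oo[ k ->
    measurable_fun (`[t1, +oo[%classic : set (leb_line R)) (fun t : leb_line R => F (k t)).
  by move=> mk; exact: (measurableT_comp mF mk).
apply: measurable_funB; apply: measurable_funM.
- exact: ma.
- apply: measurableT_comp; first exact: measurable_expR.
  by apply: measurable_funB; [exact: mF1|exact: mFc].
- exact: mb.
- apply: measurableT_comp; first exact: measurable_expR.
  by apply: measurable_funN; apply: measurable_funB; [exact: mFc|exact: mF1].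
Qed.

(** Increasing [v] increases the first exponential and decreases the second,
    which enters with a minus sign. *)
Lemma le_delay_operator (R : realType) (a b g h u v : R -> R) (t : R) :
  0 <= a t -> 0 <= b t ->
  locally_lebesgue_integrable u -> locally_lebesgue_integrable v ->
  (forall s, v s <= u s) ->
  delay_operator a b g h v t <= delay_operator a b g h u t.
Proof.
move=> a0 b0 iu iv vu.
have le p q : \int[cmu]_(s in `[p, q]) v s <=
    \int[cmu]_(s in `[p, q]) u s.
  apply: le_Rintegral => //; first exact: measurable_leb_line.
  - exact/iv/segment_compact.
  - exact/iu/segment_compact.
by apply: lerB; apply: ler_wpM2l => //; rewrite ler_expR ?lerN2 le.
Qed.

Lemma cvg_Rintegral_dominated (R : realType) (u w : R -> R)
    (v : (R -> R)^nat) (p q : R) :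
  locally_lebesgue_integrable u ->
  (forall n, measurable_fun (setT : set (leb_line R)) (v n)) ->
  measurable_fun (setT : set (leb_line R)) w ->
  (forall n t, 0 <= v n t) -> (forall n t, v n t <= u t) ->
  (forall t, v n t @[n --> \oo] --> w t) ->
  \int[cmu]_(s in `[p, q]) v n s @[n --> \oo] -->
  \int[cmu]_(s in `[p, q]) w s.
Proof.
move=> iu mv mw v0 vu vw.
have mI : measurable (`[p, q]%classic : set (leb_line R)).
  exact: measurable_leb_line.
have [||||| iw _ cv] := @dominated_convergence _ _ _
  (@completed_lebesgue_measure R) _ mI (fun n => EFin \o v n) (EFin \o w) (EFin \o u).
- by move=> n; apply/measurable_EFinP; exact: measurable_funTS.
- by apply/measurable_EFinP; exact: measurable_funTS.
- by apply: aeW => t _; apply: cvg_EFin; [exact: nearW|exact: vw].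
- exact/iu/segment_compact.
- by apply: aeW => t n _ /=; rewrite lee_fin ger0_norm.
have fw := integrable_fin_num mI iw.
by apply: fine_cvg; rewrite fineK.
Qed.

(** Monotone iteration from [u]: the iterates decrease and stay nonnegative;
    dominated convergence, with dominating function [u], lets the operator pass
    to the limit. *)
Lemma delay_operator_fixpoint (R : realType) (a b g h u : R -> R) (t1 : R) :
  lebesgue_measurable_fun `[t1, +oo[ a -> lebesgue_measurable_fun `[t1, +oo[ b ->
  lebesgue_measurable_fun `[t1, +oo[ g -> lebesgue_measurable_fun `[t1, +oo[ h ->
  (forall t, t1 <= t -> 0 <= b t) -> (forall t, t1 <= t -> b t <= a t) ->
  (forall t, t1 <= t -> g t <= t) -> (forall t, t1 <= t -> t <= h t) ->
  integral_ineq_solution a b g h t1 u ->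
  exists w, [/\ locally_lebesgue_integrable w, (forall t, 0 <= w t),
    (forall t, t < t1 -> w t = 0) &
    (forall t, t1 <= t -> w t = delay_operator a b g h w t)].
Proof.
move=> ma mb mg mh b0 ba g_le h_ge [iu u0 u_lt uI].
pose next v t := if t < t1 then 0 else delay_operator a b g h v t.
pose v n := iter n next u.
have vP n : [/\ measurable_fun (setT : set (leb_line R)) (v n),
    (forall t, 0 <= v n t), (forall t, t < t1 -> v n t = 0),
    (forall t, v n t <= u t) & (forall t, v n.+1 t <= v n t)].
  elim: n => [|n [mvn vn0 vn_lt vnu vnS]].
    split => //; first exact: locally_integrable_measurable.
    by move=> t; rewrite /v/= /next; case: ltP => // /uI.
  have ivn := dominated_locally_integrable iu mvn vn0 vnu.
  have mvS : measurable_fun (setT : set (leb_line R)) (v n.+1).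
    apply: measurable_fun_if.
    - exact: measurableT.
    - apply: measurable_fun_leb_line; exact: measurable_fun_ltr.
    - exact: measurable_cst.
    - apply: (@measurable_funS _ _ (leb_line R) R
        (`[t1, +oo[%classic : set (leb_line R))).
      + exact: measurable_leb_line.
      + by move=> t [_ /=]; rewrite in_itv/= andbT leNgt => ->.
      + exact: measurable_delay_operator.
  have vS0 t : 0 <= v n.+1 t.
    rewrite /v/= /next; case: ltP => // t1t.
    by apply: delay_operator_ge0; rewrite ?b0 ?ba.
  have vSu t : v n.+1 t <= u t by exact: le_trans (vnS t) (vnu t).
  have ivS := dominated_locally_integrable iu mvS vS0 vSu.
  split; [exact: mvS|exact: vS0| |exact: vSu|].
    by move=> t tt1; rewrite /v/= /next tt1.
  move=> t; suff : next (v n.+1) t <= next (v n) t by [].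
  rewrite /next; case: ltP => [_|t1t]; first exact: lexx.
  apply: le_delay_operator; [|exact: b0|exact: ivn|exact: ivS|exact: vnS].
  exact: le_trans (b0 _ t1t) (ba _ t1t).
have mv n : measurable_fun (setT : set (leb_line R)) (v n) by case: (vP n).
have v0 n t : 0 <= v n t by have [_ vn0 _ _ _] := vP n; exact: vn0.
have v_lt n t : t < t1 -> v n t = 0 by have [_ _ vn _ _] := vP n; exact: vn.
have vu n t : v n t <= u t by have [_ _ _ vn _] := vP n; exact: vn.
have vS n t : v n.+1 t <= v n t by have [_ _ _ _ vn] := vP n; exact: vn.
pose w t := limn (v ^~ t).
have vw t : v n t @[n --> \oo] --> w t.
  apply: nonincreasing_is_cvgn.
    by apply/nonincreasing_seqP => n; exact: vS.
  by exists 0 => _ [n _ <-].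
have w0 t : 0 <= w t by apply: limr_ge; [exact: vw|exact: nearW].
have wu t : w t <= u t by apply: limr_le; [exact: vw|exact: nearW].
have mw : measurable_fun (setT : set (leb_line R)) w.
  apply: (@measurable_fun_cvg _ (leb_line R) R setT v w) => [n|t _].
    exact: mv.
  exact: vw.
have cI p q := @cvg_Rintegral_dominated _ _ _ _ p q iu mv mw v0 vu vw.
exists w; split => //.
- exact: dominated_locally_integrable iu mw w0 wu.
- move=> t tt1; apply/le_anti; rewrite w0 andbT.
  by apply: limr_le; [exact: vw|apply: nearW => n; rewrite v_lt].
- move=> t t1t; apply: (@cvg_unique _ _ (v n.+1 t @[n --> \oo])) => //.
    by have := vw t; rewrite -(cvg_shiftS (v ^~ t)).
  have -> : (fun n => v n.+1 t) = (fun n => delay_operator a b g h (v n) t).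
    by apply/funext => n; rewrite /v/= {1}/next ltNge t1t.
  apply: cvgB; apply: cvgM; try exact: cvg_cst.
    by apply: continuous_cvg; [exact: continuous_expR|exact: cI].
  apply: continuous_cvg; first exact: continuous_expR.
  by apply: cvgN; exact: cI.
Qed.

(** * From a fixed point to a solution of the equation *)

(** The increments of the primitive over the disjoint intervals add up to the
    integral of [v] over their union, which is small when the union has small
    measure. *)
Lemma absolutely_continuous_primitive (R : realType) (v : R -> R) (p q : R) :
  locally_integrable setT v -> (forall t, 0 <= v t) ->
  absolutely_continuous_on p q (fun t => \int[mu]_(s in `[p, t]) v s).
Proof.
move=> [mv _ iv] v0 e e0.
have ivI (x y : R) : mu.-integrable `[x, y] (EFin \o v).
  apply/integrableP; split; first exact/measurable_EFinP/measurable_funTS.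
  exact/iv/segment_compact.
pose f := v \_ `[p, q].
have If : mu.-integrable setT (EFin \o f).
  by rewrite -restrict_EFin; apply/integrable_restrict => //=; rewrite setTI.
have mf : measurable_fun setT (EFin \o f) by case/integrableP: If.
have [d [d0 Hd]] := integral_normr_continuous If e0.
exists d => // n l r lr tI sd.
pose A := \big[setU/set0]_(i <- index_enum 'I_n) `]l i, r i[%classic.
have mI (i : 'I_n) : measurable (`]l i, r i[%classic : set R) by [].
have mA : measurable A by apply: bigsetU_measurable.
have tI' : trivIset [set` index_enum 'I_n] (fun i => `]l i, r i[%classic).
  by apply: sub_trivIset tI.
have muA : mu A = (\sum_(i < n) (r i - l i))%:E.
  rewrite -[LHS]mul1e -integral_cst// ge0_integral_bigsetU//=; last first.
    exact: index_enum_uniq.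
  rewrite -sumEFin; apply: eq_bigr => i _; have [_ lri _] := lr i.
  rewrite integral_cst//= mul1e lebesgue_measure_itv/= lte_fin -EFinD.
  case: ifP => // /negbT; rewrite -leNgt => rl.
  have -> : l i = r i by apply/le_anti; rewrite lri rl.
  by rewrite subrr.
have := Hd _ mA; rewrite /= muA lte_fin => /(_ sd); apply: le_lt_trans.
have -> : \int[mu]_(x in A) `|f x| =
    \sum_(i < n) \int[mu]_(x in `[l i, r i]) v x.
  rewrite /Rintegral ge0_integral_bigsetU//=; last 2 first.
  - exact: index_enum_uniq.
  - apply: measurable_funTS; apply/measurable_EFinP.
    by apply: measurableT_comp => //; exact/measurable_EFinP.
  have E (i : 'I_n) : (\int[mu]_(x in `]l i, r i[) (`|f x|)%:E =
      \int[mu]_(x in `[l i, r i]) (v x)%:E)%E.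
    have [pl _ rq] := lr i.
    rewrite integral_itv_bndo_bndc; last first.
      apply: measurable_funTS; apply/measurable_EFinP.
      by apply: measurableT_comp => //; exact/measurable_EFinP.
    rewrite integral_itv_obnd_cbnd; last first.
      apply: measurable_funTS; apply/measurable_EFinP.
      by apply: measurableT_comp => //; exact/measurable_EFinP.
    apply: eq_integral => x; rewrite inE/= in_itv/= => /andP[lx xr].
    rewrite /f patchE mem_set ?ger0_norm//= in_itv/=.
    by rewrite (le_trans pl lx) (le_trans xr rq).
  rewrite (eq_bigr (fun i => (\int[mu]_(x in `[l i, r i]) v x)%:E)).
    by rewrite sumEFin.
  by move=> i _; rewrite E /Rintegral fineK//; exact: integrable_fin_num.
rewrite le_eqVlt; apply/orP; left; apply/eqP; apply: eq_bigr => i _.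
have [pl lri rq] := lr i.
rewrite (Rintegral_split (ivI p (r i)) pl lri) addrAC subrr add0r.
by rewrite ger0_norm// Rintegral_ge0.
Qed.

Lemma absolutely_continuous_comp (R : realType) (p q : R) (F x : R -> R) :
  (forall s t, p <= s -> s <= t -> `|x t - x s| <= `|F t - F s|) ->
  absolutely_continuous_on p q F -> absolutely_continuous_on p q x.
Proof.
move=> xF acF e /acF[d d0 Hd]; exists d => // n l r lr tI sd.
apply: le_lt_trans (Hd n l r lr tI sd); apply: ler_sum => i _.
by have [pl lri _] := lr i; exact: xF.
Qed.

(** The derivative of [s |-> expR (- s)] is bounded by [1] on the nonnegative
    half-line. *)
Lemma expRN_contracting (R : realType) (s t : R) :
  0 <= s -> s <= t -> `|expR (- t) - expR (- s)| <= `|t - s|.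
Proof.
move=> s0 st; rewrite distrC !ger0_norm ?subr_ge0// ?ler_expR ?lerN2//.
have -> : - t = - s + - (t - s) by rewrite opprB addrA addNr add0r.
rewrite expRD -[X in X - _]mulr1 -mulrBr.
have h1 : 1 - expR (- (t - s)) <= t - s.
  by rewrite lerBlDl -lerBlDr; exact: expR_ge1Dx.
apply: le_trans h1; rewrite ler_piMl//.
  by rewrite subr_ge0 -[leRHS]expR0 ler_expR oppr_le0 subr_ge0.
by rewrite -[leRHS]expR0 ler_expR oppr_le0.
Qed.

(** The witness is [x t = expR (- F t)] with [F] the primitive of [w] from [t1].
    To the left of [t1] the interval of integration is empty, so [x = 1] there,
    which is the initial function. *)
Lemma solution_of_fixpoint (R : realType) (a b g h w : R -> R) (t0 t1 : R) :
  t0 <= t1 -> (forall t, t1 <= t -> g t <= t) -> (forall t, t1 <= t -> t <= h t) ->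
  locally_lebesgue_integrable w -> (forall t, 0 <= w t) ->
  (forall t, t < t1 -> w t = 0) ->
  (forall t, t1 <= t -> w t = delay_operator a b g h w t) ->
  has_eventually_positive_nonincreasing_solution (mixed_eq a b g h) t0.
Proof.
move=> t01 g_le h_ge iw w0 w_lt w_fix.
have [v [lv v0 vw E]] := locally_integrable_representative iw w0.
pose F t := \int[cmu]_(s in `[t1, t]) w s.
have FE : F = fun t => \int[mu]_(s in `[t1, t]) v s.
  by apply/funext => t; rewrite /F E.
have F0 t : 0 <= F t by exact: Rintegral_ge0.
have ndF : nondecreasing_fun F by exact: nondecreasing_primitive.
pose x t := expR (- F t).
exists t1, x, (x t1), x; split => //; last first.
  exists t1; split; first by move=> t _; exact: expR_gt0.
  by move=> s t _ st; rewrite ler_expR lerN2 ndF.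
split => //.
- move=> c _; apply: (absolutely_continuous_comp (F := F)).
    by move=> s t _ st; apply: expRN_contracting => //; exact: ndF.
  by rewrite FE; exact: absolutely_continuous_primitive.
- have [mv _ iv] := lv.
  have ivI (y : R) : mu.-integrable [set` Interval (BLeft t1) (BRight y)] (EFin \o v).
    apply/integrableP; split; first exact/measurable_EFinP/measurable_funTS.
    exact/iv/segment_compact.
  have ne : {ae (@lebesgue_measure R), forall t, t != t1}.
    exists [set t1]; split => //; first exact: lebesgue_measure_set1.
    by move=> t /= /negP; rewrite negbK => /eqP.
  have := ae_completedI (ae_completedI (ae_completed (FTC1 ivI lv)) vw)
    (ae_completed ne).
  rewrite -FE; apply: ae_completedS => t [[+ vwt] tt1] t1t.
  have t1t' : t1 < t by rewrite lt_neqAle eq_sym tt1.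
  rewrite lte_fin => /(_ t1t')[dF F't].
  have dx : is_derive t (1:R) x (expR (- F t) * - w t).
    apply: (@is_derive1_comp _ expR (- F)).
    apply: is_deriveN; rewrite -vwt -F't derive1E; exact: derivableP.
  split; first exact: ex_derive.
  have wE : w t = a t * expR (F t - F (g t)) - b t * expR (- (F (h t) - F t)).
    rewrite {1}w_fix//.
    exact: (delay_operator_primitive _ _ iw w0 w_lt t1t (g_le _ t1t) (h_ge _ t1t)).
  rewrite /mixed_eq derive1E derive_val wE /x mulrN mulrBr.
  have -> : expR (- F t) * (b t * expR (- (F (h t) - F t))) =
      b t * expR (- F (h t)).
    by rewrite mulrCA -expRD opprB addrA addNr add0r.
  have -> : expR (- F t) * (a t * expR (F t - F (g t))) =
      a t * expR (- F (g t)).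
    by rewrite mulrCA -expRD addrA addNr add0r.
  by rewrite opprB subrK subrr.
Qed.

(** * The equivalence *)

Theorem theorem1 (R : realType) (t0 : R) (a b g h : R -> R)
    (a_meas : lebesgue_measurable_fun `[t0, +oo[ a)
    (b_meas : lebesgue_measurable_fun `[t0, +oo[ b)
    (g_meas : lebesgue_measurable_fun `[t0, +oo[ g)
    (h_meas : lebesgue_measurable_fun `[t0, +oo[ h)
    (a_bnd : locally_ess_bounded t0 a)
    (b_bnd : locally_ess_bounded t0 b)
    (g_bnd : locally_ess_bounded t0 g)
    (h_bnd : locally_ess_bounded t0 h)
    (a_ge0 : forall t, t0 <= t -> 0 <= a t)
    (b_ge0 : forall t, t0 <= t -> 0 <= b t)
    (g_le : forall t, t0 <= t -> g t <= t)
    (h_ge : forall t, t0 <= t -> t <= h t)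
    (g_lim : g t @[t --> +oo] --> +oo)
    (b_le_a : forall t, t0 <= t -> b t <= a t) :
  [<-> has_eventually_positive_nonincreasing_solution (mixed_ineq a b g h) t0;
       exists2 t1, t0 <= t1 & exists u, integral_ineq_solution a b g h t1 u;
       has_eventually_positive_nonincreasing_solution (mixed_eq a b g h) t0].
Proof.
tfae.
- exact: integral_ineq_of_solution.
- move=> [t1 t01 [u uI]].
  have sub k : lebesgue_measurable_fun `[t0, +oo[ k ->
      lebesgue_measurable_fun `[t1, +oo[ k.
    apply: (@measurable_funS _ _ (leb_line R) R).
      exact: measurable_leb_line.
    by move=> t /=; rewrite !in_itv/= !andbT; exact: le_trans.
  have [w [iw w0 w_lt w_fix]] : exists w, [/\ locally_lebesgue_integrable w,
      (forall t, 0 <= w t), (forall t, t < t1 -> w t = 0) &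
      (forall t, t1 <= t -> w t = delay_operator a b g h w t)].
    apply: (delay_operator_fixpoint _ _ _ _ _ _ _ _ uI).
    - exact: sub.
    - exact: sub.
    - exact: sub.
    - exact: sub.
    - by move=> t /(le_trans t01); exact: b_ge0.
    - by move=> t /(le_trans t01); exact: b_le_a.
    - by move=> t /(le_trans t01); exact: g_le.
    - by move=> t /(le_trans t01); exact: h_ge.
  apply: (solution_of_fixpoint t01 _ _ iw w0 w_lt w_fix).
    by move=> t /(le_trans t01); exact: g_le.
  by move=> t /(le_trans t01); exact: h_ge.
- move=> [t1 [phi [x0 [x [t01 [acx sol x_phi xt1] xpos]]]]].
  exists t1, phi, x0, x; split => //; split => //.
  apply: ae_completedS sol => t Ht t1t; have [dx Ex] := Ht t1t.
  by split => //; rewrite /mixed_ineq; rewrite /mixed_eq in Ex; rewrite Ex.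
Qed.
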